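(* The map $Y\mapsto\lambda^Y$ defines a bijection between the set $\mathsf{PDgm}$ of persistence diagrams and the set of landscape sequences. That is: (1) for every $Y\in\mathsf{PDgm}$, its persistence landscape $\lambda^Y$ is a landscape sequence; and (2) every landscape sequence $\lambda$ is the persistence landscape $\lambda=\lambda^Y$ of a unique persistence diagram $Y\in\mathsf{PDgm}$.
   Context: Let $\mathbb{R}^2_<=\{(b,d)\in\mathbb{R}^2: b<d\}$. A persistence diagram is a finite (possibly empty) multiset $Y=\{(b_i,d_i)\}_{i=1}^N$ of points of $\mathbb{R}^2_<$; $\mathsf{PDgm}$ is the set of all of them. For $b\le d$, $\mathrm{rank}[Y](b,d)$ is the number (with multiplicity) of $(b_i,d_i)\in Y$ with $b_i\le b\le d<d_i$. The persistence landscape of $Y$ is the sequence $\lambda^Y=(\lambda^Y_1,\lambda^Y_2,\dots)$ of functions $\lambda^Y_k(t)=\sup\{h\ge0:\mathrm{rank}[Y](t-h,t+h)\ge k\}$ (supremum of the empty set being $0$), an element of $L^\infty(\mathbb{N}\times\mathbb{R})$, $\mathbb{N}=\{1,2,\dots\}$. A landscape curve is a function $\mathbb{R}\to\mathbb{R}$ that is non-negative, continuous, piecewise-linear, compactly supported, differentiable except at finitely many points (its critical points), and whose derivative at each non-critical point of its support is $+1$ or $-1$. (Hence each critical point is a local maximum or a local minimum, exclusively.) A pair $(t,h)$ is called a local max. (min.) of a curve if the curve has value $h$ at $t$ and $t$ is a critical point which is a local maximum (minimum) of the curve. A landscape sequence is a sequence $\lambda=(\lambda_1,\lambda_2,\dots)$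 of functions $\mathbb{R}\to\mathbb{R}$ such that: each $\lambda_k$ is a landscape curve; $\lambda_k(t)\ge\lambda_{k+1}(t)$ for all $k\in\mathbb{N}$, $t\in\mathbb{R}$; there is $K\in\mathbb{N}$ with $\lambda_k=0$ for all $k\ge K$; and every $(t,h)\in\mathbb{R}^2$ with $h>0$ satisfies $\deg_\lambda(t,h)\ge0$, where $\deg_\lambda(t,h)=|\{k:(t,h)\text{ is a local max. of }\lambda_k\}|-|\{k:(t,h)\text{ is a local min. of }\lambda_k\}|$. *)

(* Defs.v *)
From HB Require Import structures.
From mathcomp Require Import all_boot all_order all_algebra.
From mathcomp Require Import finmap multiset.
From mathcomp Require Import all_classical all_reals all_analysis.

Set Implicit Arguments.
Unset Strict Implicit.
Unset Printing Implicit Defensive.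

Import Order.TTheory GRing.Theory Num.Theory.
Import numFieldNormedType.Exports.

Local Open Scope classical_set_scope.
Local Open Scope ring_scope.

Section Diagrams.
Variable R : realType.

Definition R2lt := {p : R * R | p.1 < p.2}.

Definition PDgm := {mset R2lt}%mset.

(* The value of a multiset at a point is the multiplicity of that point. *)
Definition rank (Y : PDgm) (b d : R) : nat :=
  (\sum_(p <- finsupp Y | [&& (val p).1 <= b, b <= d & d < (val p).2]%R) Y p)%N.

(* Sequences of functions are indexed from 0: [landscape Y k] is the
   (k+1)-st landscape function. The set below is bounded above, and
   [sup set0 = 0] by convention in the library. *)
Definition landscape (Y : PDgm) (k : nat) (t : R) : R :=
  sup [set h : R | 0 <= h /\ (k.+1 <= rank Y (t - h) (t + h))%N].

End Diagrams.

Section Curves.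
Variable R : realType.
Implicit Types (f : R -> R) (t h : R).

(* Finitely many breakpoints, and [f] is affine on each compact interval
   whose interior contains no breakpoint. *)
Definition piecewise_linear f : Prop :=
  exists s : seq R, forall a b : R,
    (forall x, x \in s -> ~ (a < x < b)) ->
    exists m c : R, forall x, a <= x <= b -> f x = m * x + c.

Definition support f : set R := closure [set t | f t != 0].

Definition critical f t : Prop := ~ derivable f t 1.

Record landscape_curve f : Prop := LandscapeCurve {
  curve_ge0 : forall t, 0 <= f t;
  curve_continuous : continuous f;
  curve_piecewise_linear : piecewise_linear f;
  curve_compact_support : compact (support f);
  curve_finite_critical : finite_set [set t | critical f t];
  curve_slope : forall t, support f t -> ~ critical f t ->
    f^`()%classic t = 1 \/ f^`()%classic t = -1 }.

Definition is_local_max f t h : Prop :=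
  [/\ f t = h, critical f t & \forall x \near t, f x <= f t].

Definition is_local_min f t h : Prop :=
  [/\ f t = h, critical f t & \forall x \near t, f t <= f x].

(* [fset_set] returns the empty set on an infinite set; the two sets of indices
   are finite whenever [h > 0] and the functions [l k] are eventually zero. *)
Definition deg (l : nat -> R -> R) t h : int :=
  #|` fset_set [set k | is_local_max (l k) t h]|%:Z
  - #|` fset_set [set k | is_local_min (l k) t h]|%:Z.

Record landscape_sequence (l : nat -> R -> R) : Prop := LandscapeSequence {
  seq_curve : forall k, landscape_curve (l k);
  seq_decreasing : forall k t, l k.+1 t <= l k t;
  seq_eventually_zero :
    exists K : nat, forall k, (K <= k)%N -> forall t, l k t = 0;
  seq_deg_ge0 : forall t h, 0 < h -> 0 <= deg l t h }.

End Curves.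

(* Main.v *)
Require Import Defs.
From mathcomp Require Import all_boot all_order all_algebra.
From mathcomp Require Import finmap multiset.
From mathcomp Require Import all_classical all_reals all_analysis.
From mathcomp Require Import ring lra zify.

(** The degree function of a landscape sequence, read through the change of
    coordinates b = t - h, d = t + h, is the diagram it comes from; both
    directions of the bijection follow from two facts about this function.

    Locally, a landscape curve has slope 1 or -1 on each side of a point of
    positive height, a maximum rises then falls, a minimum falls then rises. So
    the degree at (t, h) is the number of curves that rise into (t, h) minus the
    number of curves that rise out of it (local_extrema_rises, deg_count).

    First, the degree function determines the sequence (deg_determines). Along a
    line of slope 1, the number of curves that rise out of the moving point only
    changes where the degree is nonzero, and drops there by the degree. Along a
    line of slope -1, the number of curves strictly above the moving point only
    changes by these numbers of rising curves. Both quantities vanish far away,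
    hence are determined by the degrees, and the numbers of curves above all
    points give back the decreasing sequence of functions.

    Second, the landscape of a diagram Y is made of landscape curves, and its
    degree at a point is the multiplicity of that point in Y. The curves are
    1-Lipschitz and select their values among finitely many lines, hence are
    piecewise linear (landscape_selection, continuous_selection_piecewise,
    landscape_landscape_curve). The number of them strictly above (t, h) is the
    number of points of Y with b < t - h and t + h < d (landscape_gt), and taking
    its jumps along the two diagonal directions isolates the points with
    b = t - h and d = t + h (deg_landscape).

    The degrees of a landscape are thus nonnegative, Y is recovered from them,
    and a landscape sequence l is the landscape of the diagram given by its
    degree function, since the two have equal degrees. *)

Set Implicit Arguments.
Unset Strict Implicit.
Unset Printing Implicit Defensive.

Import Order.TTheory GRing.Theory Num.Theory.
Import numFieldNormedType.Exports.

Local Open Scope classical_set_scope.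
Local Open Scope ring_scope.

(** * One-sided neighbourhoods *)

Section Germs.
Variable R : realType.
Implicit Types (f : R -> R) (t h : R) (P : set R).

Lemma near_right0P P :
  (\forall s \near 0^'+, P s) <->
  exists2 e : R, 0 < e & forall s, 0 < s -> s < e -> P s.
Proof.
split=> [[e /= e0 eP]|[e e0 eP]].
  exists e => // s s0 se; apply: eP => //=.
  by rewrite sub0r normrN gtr0_norm.
exists e => //= s /=; rewrite sub0r normrN => se s0.
by apply: eP => //; rewrite gtr0_norm in se.
Qed.

Lemma near_ballP t P :
  (\forall x \near t, P x) <->
  exists2 e : R, 0 < e & forall x, `|x - t| < e -> P x.
Proof.
split=> [[e /= e0 eP]|[e e0 eP]].
  by exists e => // x xt; apply: eP => /=; rewrite distrC.
by exists e => //= x /= xt; apply: eP; rewrite distrC.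
Qed.

Lemma near_right_of t P :
  (\forall x \near t, P x) -> \forall s \near 0^'+, P (t + s).
Proof.
move=> /near_ballP[e e0 eP]; apply/near_right0P; exists e => // s s0 se.
by apply: eP; rewrite addrC addKr gtr0_norm.
Qed.

Lemma near_left_of t P :
  (\forall x \near t, P x) -> \forall s \near 0^'+, P (t - s).
Proof.
move=> /near_ballP[e e0 eP]; apply/near_right0P; exists e => // s s0 se.
by apply: eP; rewrite addrC addKr normrN gtr0_norm.
Qed.

Lemma near_two_sided t P : P t ->
  (\forall s \near 0^'+, P (t + s)) -> (\forall s \near 0^'+, P (t - s)) ->
  \forall x \near t, P x.
Proof.
move=> Pt /near_right0P[e e0 eP] /near_right0P[d d0 dP].
apply/near_ballP; exists (Num.min e d) => [|x]; first by rewrite lt_min e0.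
rewrite lt_min => /andP[xe xd].
have [xt|tx|->//] := ltgtP x t.
  rewrite (_ : x = t - (t - x)); last by lra.
  by apply: dP; move: xd; rewrite ?ltr0_norm; lra.
rewrite (_ : x = t + (x - t)); last by lra.
by apply: eP; move: xe; rewrite ?gtr0_norm; lra.
Qed.

(** Connectedness of the segment, in the form used by every sweeping argument
    below: a quantity that never jumps keeps its initial value. *)
Lemma locally_constant_segment (T : Type) (F : R -> T) a b : a <= b ->
  (forall x, a <= x <= b -> \forall y \near x, F y = F x) -> F a = F b.
Proof.
move=> ab Floc'.
have Floc x : x \in `[a, b] -> \forall y \near x, F y = F x.
  by rewrite in_itv; exact: Floc'.
pose A := `[a, b]%classic `&` [set x | F x = F a].
suff : A = `[a, b]%classic.
  by move/seteqP => [_ /(_ b)]; rewrite /= in_itv /= lexx ab => /(_ isT) [].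
apply: (@segment_connected R a b).
- by exists a; split => //=; rewrite in_itv /= lexx.
- exists [set x | \forall y \near x, F y = F a].
    exact: open_interior.
  rewrite /A; apply/seteqP; split=> x [xab] /= Fx; split=> //.
    by apply: filterS (Floc _ xab) => y ->.
  by have /= := nbhs_singleton Fx.
exists (~` [set x | \forall y \near x, F y <> F a]).
  by apply: open_closedC; exact: open_interior.
rewrite /A; apply/seteqP; split=> x [xab] /= Fx; split=> //.
  by move=> /nbhs_singleton.
apply: contrapT => Fxa; apply: Fx.
by apply: filterS (Floc _ xab) => y ->.
Qed.

Lemma derive_right f t m : derivable f t 1 ->
  (\forall s \near 0^'+, f (t + s) = f t + m * s) -> f^`()%classic t = m.
Proof.
move=> /cvg_ex[/= l fl] fm; rewrite derive1E /derive (cvg_lim _ fl)//.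
have fr : (fun s => s^-1 *: (f (s *: 1 + t) - f t)) @ (0:R)^'+ --> l.
  apply: cvg_trans fl; apply: cvg_app.
  by apply: within_subset => x /= /gt_eqF ->.
suff fm' : (fun s => s^-1 *: (f (s *: 1 + t) - f t)) @ (0:R)^'+ --> m.
  exact: cvg_unique fr fm'.
apply: cvg_near_cst; near=> s.
have s0 : 0 < s by [].
have -> : s *: 1 + t = t + s by rewrite [s *: 1]mulr1 addrC.
rewrite (near fm s) // /GRing.scale /=; field; lra.
Unshelve. all: by end_near. Qed.

Lemma derive_left f t m : derivable f t 1 ->
  (\forall s \near 0^'+, f (t - s) = f t - m * s) -> f^`()%classic t = m.
Proof.
move=> /cvg_ex[/= l fl] fm; rewrite derive1E /derive (cvg_lim _ fl)//.
have fr : (fun s => s^-1 *: (f (s *: 1 + t) - f t)) @ (0:R)^'- --> l.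
  apply: cvg_trans fl; apply: cvg_app.
  by apply: within_subset => x /= /lt_eqF ->.
suff fm' : (fun s => s^-1 *: (f (s *: 1 + t) - f t)) @ (0:R)^'- --> m.
  exact: cvg_unique fr fm'.
apply: cvg_near_cst; apply/nbhs_left0P; near=> s.
have s0 : 0 < s by [].
have -> : (0 - s) *: 1 + t = t - s by rewrite [_ *: 1]mulr1 sub0r addrC.
rewrite (near fm s) // /GRing.scale /=; field; lra.
Unshelve. all: by end_near. Qed.

Lemma near_neq t h : t != h -> \forall x \near t, x != h.
Proof.
move=> th; apply/near_ballP; exists `|h - t|.
  by rewrite normr_gt0 subr_eq0 eq_sym.
by move=> x; apply: contraL => /eqP ->; rewrite ltxx.
Qed.

Lemma near_all_seq (T : eqType) (F : set_system R) {FF : Filter F} (s : seq T)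
    (P : T -> R -> Prop) :
  (forall p, p \in s -> \forall x \near F, P p x) ->
  \forall x \near F, forall p, p \in s -> P p x.
Proof.
elim: s => [|p s ih] Ps; first by apply: nearW => x p; rewrite in_nil.
have Pp := Ps p (mem_head _ _).
have {}ih : \forall x \near F, forall q, q \in s -> P q x.
  by apply: ih => q qs; apply: Ps; rewrite inE qs orbT.
by apply: filterS2 Pp ih => x px qx q; rewrite inE => /orP[/eqP->|/qx].
Qed.
End Germs.

(** * Piecewise affine functions *)

Section PiecewiseAffine.
Variable R : realType.
Implicit Types (f : R -> R) (t h : R) (s : seq R) (Q : R -> R -> Prop).

(** Piecewise linearity that remembers, through [Q], which lines the pieces may
    lie on; for a landscape this is what forces its slopes to be 0, 1 or -1. *)
Definition piecewise_in Q f := exists s, forall a b, a < b ->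
  (forall x, x \in s -> ~ (a < x < b)) ->
  exists m c, Q m c /\ forall x, a <= x <= b -> f x = m * x + c.

Lemma piecewise_in_right Q f t : piecewise_in Q f ->
  exists m c, [/\ Q m c, f t = m * t + c &
                  \forall s \near 0^'+, f (t + s) = m * (t + s) + c].
Proof.
move=> [s fs].
have /near_right0P[e e0 es] :
    \forall e \near (0:R)^'+, forall x, x \in s -> ~ (t < x < t + e).
  apply: near_all_seq => x _; apply/near_right0P.
  by case: (ltP t x) => tx; [exists (x - t) => [|u u0 ux]|exists 1 => [|u u0 ux]]; lra.
have e20 : 0 < e / 2 by lra.
have [||m [c [Qmc mc]]] := fs t (t + e / 2); first by lra.
  by move=> x xs; apply: es => //; lra.
exists m, c; split => //; first by apply: mc; lra.
by apply/near_right0P; exists (e / 2) => // u u0 ue; apply: mc; lra.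
Qed.

Lemma piecewise_in_left Q f t : piecewise_in Q f ->
  exists m c, [/\ Q m c, f t = m * t + c &
                  \forall s \near 0^'+, f (t - s) = m * (t - s) + c].
Proof.
move=> [s fs].
have /near_right0P[e e0 es] :
    \forall e \near (0:R)^'+, forall x, x \in s -> ~ (t - e < x < t).
  apply: near_all_seq => x _; apply/near_right0P.
  by case: (ltP x t) => tx; [exists (t - x) => [|u u0 ux]|exists 1 => [|u u0 ux]]; lra.
have e20 : 0 < e / 2 by lra.
have [||m [c [Qmc mc]]] := fs (t - e / 2) t; first by lra.
  by move=> x xs; apply: es => //; lra.
exists m, c; split => //; first by apply: mc; lra.
by apply/near_right0P; exists (e / 2) => // u u0 ue; apply: mc; lra.
Qed.

Lemma derivable_near_affine f t m c :
  (\forall x \near t, f x = m * x + c) -> derivable f t 1.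
Proof.
move=> fmc; apply: (@near_eq_derivable _ _ _ (fun x => m * x + c)).
  by apply: filterS fmc => x ->.
by apply: derivableD => //; apply: derivableM.
Qed.

Lemma piecewise_in_critical Q f :
  piecewise_in Q f -> finite_set [set t | critical f t].
Proof.
move=> [s fs]; apply: (sub_finite_set _ (finite_seq s)) => t /= ft.
apply: contrapT => ts; apply: ft.
have /near_ballP[e e0 es] :
    \forall x \near t, forall y, y \in s -> x != y.
  apply: (@near_all_seq _ _ (nbhs t)) => y ys; apply: near_neq.
  by apply/eqP => ty; apply: ts; rewrite ty.
have [||m [c [Qmc mc]]] := fs (t - e / 2) (t + e / 2); first by lra.
  move=> x xs xt; have := es x; rewrite ltr_norml => /(_ _ x xs).
  by rewrite eqxx => H; have : false by apply: H; lra.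
apply: (@derivable_near_affine _ _ m c); apply/near_ballP.
exists (e / 2) => [|x]; first by lra.
by rewrite ltr_norml => xt; apply: mc; lra.
Qed.

(** By continuity a selection of finitely many lines can only leave a line where
    it meets another one, so the crossing points serve as breakpoints. *)
Lemma continuous_selection_piecewise (L : seq (R * R)) f : continuous f ->
  (forall t, exists2 l, l \in L & f t = l.1 * t + l.2) ->
  piecewise_in (fun m c => (m, c) \in L) f.
Proof.
move=> fcont fL.
pose cross (l l' : R * R) := (l'.2 - l.2) / (l.1 - l'.1).
exists [seq cross l l' | l <- L, l' <- L] => a b ab free.
have [[m c]/= mcL fmc] := fL ((a + b) / 2).
exists m, c; split=> //.
have cont x (l : R * R) : f x != l.1 * x + l.2 ->
    \forall y \near x, f y != l.1 * y + l.2.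
  move=> fx; suff : \forall y \near x, f y - l.1 * y != l.2.
    by apply: filterS => y; apply: contra_neq; lra.
  have gx : (fun y => f y - l.1 * y) @ x --> f x - l.1 * x.
    by apply: cvgB; [exact: fcont|apply: cvgM; [exact: cvg_cst|exact: cvg_id]].
  apply: (gx [set z | z != l.2]); apply: near_neq.
  by apply: contra_neq fx; lra.
(* On the open segment, lying on the line is a locally constant property. *)
have inside x : a < x < b -> f x = m * x + c.
  move=> xab; apply/eqP.
  have loc y : a < y < b -> \forall z \near y,
      (f z == m * z + c) = (f y == m * y + c).
    move=> yab; have [fy|fy] := eqVneq (f y) (m * y + c); last first.
      by apply: filterS (cont y (m, c) fy) => z /negbTE.
    have : \forall z \near y, forall l, l \in L -> l != (m, c) ->
        f z != l.1 * z + l.2.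
      apply: (@near_all_seq _ _ (nbhs y)) => l lL; have [_|lmc] := eqVneq l (m, c).
        exact: nearW.
      suff : f y != l.1 * y + l.2 by move=> /cont; apply: filterS.
      rewrite fy; apply/eqP => yl.
      have lm : l.1 != m.
        apply: contra_neq lmc => lm; move: yl; rewrite lm => /addrI ->.
        by rewrite -lm; case: (l).
      apply: (free y _ yab); apply/allpairsP; exists (l, (m, c)); split=> //=.
      rewrite /cross /=.
      have lm' : l.1 - m != 0 by rewrite subr_eq0.
      by apply: (mulIf lm'); rewrite divfK //; lra.
    apply: filterS => z zL; apply/eqP.
    have [l lL fz] := fL z; have [lmc|lmc] := eqVneq l (m, c).
      by rewrite fz lmc.
    by have := zL l lL lmc; rewrite fz eqxx.
  have mab : a < (a + b) / 2 < b by lra.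
  have [xm|mx] := leP x ((a + b) / 2).
    rewrite (locally_constant_segment (F := fun z => f z == m * z + c) xm).
      by rewrite fmc.
    by move=> y ym; apply: loc; lra.
  rewrite -(locally_constant_segment (F := fun z => f z == m * z + c) (ltW mx)).
    by rewrite fmc.
  by move=> y ym; apply: loc; lra.
move=> x /andP[ax xb]; apply/eqP; apply: contraT => /(cont x (m, c)) /= fx.
have [xa|xa] := eqVneq x a.
  near (0:R)^'+ => s; have s0 : 0 < s by [].
  have sab : s < b - a by near: s; apply: nbhs_right_lt; lra.
  have : f (x + s) != m * (x + s) + c by near: s; exact: near_right_of fx.
  by rewrite inside ?eqxx //; lra.
have [xb'|xb'] := eqVneq x b.
  near (0:R)^'+ => s; have s0 : 0 < s by [].
  have sab : s < b - a by near: s; apply: nbhs_right_lt; lra.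
  have : f (x - s) != m * (x - s) + c by near: s; exact: near_left_of fx.
  by rewrite inside ?eqxx //; lra.
have /nbhs_singleton := fx; rewrite inside ?eqxx// !lt_neqAle ax xb.
by rewrite eq_sym xa xb'.
Unshelve. all: by end_near. Qed.
End PiecewiseAffine.

(** * Local behaviour of a landscape curve *)

Section CurveGerms.
Variable R : realType.
Implicit Types (f : R -> R) (t h : R).

(** The word rising or falling always refers to increasing time, also on the
    left of [t]: [rises_left] is slope 1 there, [falls_left] is slope -1. *)
Definition rises_right f t h :=
  f t = h /\ \forall s \near 0^'+, f (t + s) = h + s.

Definition rises_left f t h :=
  f t = h /\ \forall s \near 0^'+, f (t - s) = h - s.

Definition falls_right f t h :=
  f t = h /\ \forall s \near 0^'+, f (t + s) = h - s.

Definition falls_left f t h :=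
  f t = h /\ \forall s \near 0^'+, f (t - s) = h + s.

Variables (f : R -> R) (curve_f : landscape_curve f).

Let fcont t : f @ t --> f t.
Proof. exact: curve_continuous. Qed.

Let gcont t : (fun x => f x - x) @ t --> f t - t.
Proof. by apply: (@cvgB R R R (nbhs t) _ f id (f t) t) => //; exact: fcont. Qed.

Let near_gt t h : h < f t -> \forall x \near t, h < f x.
Proof. by move=> ht; exact: (@cvgr_gt R R (nbhs t) _ f (f t) (@fcont t) h ht). Qed.

Let near_lt t h : f t < h -> \forall x \near t, f x < h.
Proof. by move=> ht; exact: (@cvgr_lt R R (nbhs t) _ f (f t) (@fcont t) h ht). Qed.

Let near_gt_left t h (ht : h < f t) := near_left_of (near_gt ht).
Let near_gt_right t h (ht : h < f t) := near_right_of (near_gt ht).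
Let near_lt_left t h (ht : f t < h) := near_left_of (near_lt ht).
Let near_lt_right t h (ht : f t < h) := near_right_of (near_lt ht).

Lemma curve_piecewise_in : piecewise_in (fun _ _ => True) f.
Proof.
have [s fs] := curve_piecewise_linear curve_f.
by exists s => a b _ /fs[m [c mc]]; exists m, c.
Qed.

Lemma affine_slope t m c : 0 < f t ->
  (\forall x \near t, f x = m * x + c) -> m = 1 \/ m = -1.
Proof.
move=> ft0 fmc.
have df := derivable_near_affine fmc.
have <- : f^`()%classic t = m.
  apply: derive_right => //.
  have ft := nbhs_singleton fmc.
  by apply: filterS (near_right_of fmc) => s ->; rewrite ft; ring.
apply: (curve_slope curve_f); last by move=> cf; apply: cf.
by apply: subset_closure => /=; rewrite gt_eqF.
Qed.

Lemma right_slope t h : f t = h -> 0 < h ->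
  rises_right f t h \/ falls_right f t h.
Proof.
move=> fth h0.
have [m [c [_ ftm fmc]]] := piecewise_in_right t curve_piecewise_in.
have ft0 : 0 < f t by rewrite fth.
have /near_right0P[e e0 fe] : \forall s \near 0^'+,
    f (t + s) = m * (t + s) + c /\ 0 < f (t + s).
  exact: filterI fmc (near_right_of (near_gt ft0)).
have mE : m = 1 \/ m = -1.
  apply: (@affine_slope (t + e / 2) m c); first by apply: (fe _ _ _).2; lra.
  apply/near_ballP; exists (e / 2) => [|x]; first by lra.
  rewrite ltr_norml => xt; rewrite (_ : x = t + (x - t)); last by lra.
  by apply: (fe _ _ _).1; lra.
by case: mE => mE; [left|right]; split=> //;
  apply: filterS fmc => s ->; rewrite -fth ftm mE; ring.
Qed.

Lemma left_slope t h : f t = h -> 0 < h ->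
  rises_left f t h \/ falls_left f t h.
Proof.
move=> fth h0.
have [m [c [_ ftm fmc]]] := piecewise_in_left t curve_piecewise_in.
have ft0 : 0 < f t by rewrite fth.
have /near_right0P[e e0 fe] : \forall s \near 0^'+,
    f (t - s) = m * (t - s) + c /\ 0 < f (t - s).
  exact: filterI fmc (near_left_of (near_gt ft0)).
have mE : m = 1 \/ m = -1.
  apply: (@affine_slope (t - e / 2) m c); first by apply: (fe _ _ _).2; lra.
  apply/near_ballP; exists (e / 2) => [|x]; first by lra.
  rewrite ltr_norml => xt; rewrite (_ : x = t - (t - x)); last by lra.
  by apply: (fe _ _ _).1; lra.
by case: mE => mE; [left|right]; split=> //;
  apply: filterS fmc => s ->; rewrite -fth ftm mE; ring.
Qed.

Lemma rises_falls_right t h : rises_right f t h -> ~ falls_right f t h.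
Proof.
move=> [_ rf] [_ ff]; near (0:R)^'+ => s.
have s0 : 0 < s by [].
have := near rf s; rewrite (near ff s) // => H; have : h - s = h + s by apply: H.
lra.
Unshelve. all: by end_near. Qed.

Lemma rises_falls_left t h : rises_left f t h -> ~ falls_left f t h.
Proof.
move=> [_ rf] [_ ff]; near (0:R)^'+ => s.
have s0 : 0 < s by [].
have := near rf s; rewrite (near ff s) // => H; have : h + s = h - s by apply: H.
lra.
Unshelve. all: by end_near. Qed.

(** Moving up and left along a line of slope -1 crosses no curve: a curve through
    [(t, h)] either runs along that line or goes below it. *)
Lemma above_left t h : 0 < h ->
  \forall s \near 0^'+, (h + s < f (t - s)) = (h < f t).
Proof.
move=> h0; have [hf|fh|fth] := ltgtP h (f t).
- have mf : (h + f t) / 2 < f t by lra.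
  near=> s; apply: (@lt_trans _ _ ((h + f t) / 2)).
    have : s < (f t - h) / 2 by near: s; apply: nbhs_right_lt; lra.
    lra.
  by near: s; exact: near_gt_left.
- near=> s; apply/negbTE; rewrite -leNgt; apply: ltW.
  apply: (@lt_trans _ _ h); last by rewrite ltrDl.
  by near: s; exact: near_lt_left.
- have [[_ fl]|[_ fl]] := left_slope (esym fth) h0.
    near=> s; rewrite (near fl s) //; have s0 : 0 < s by [].
    by apply/negbTE; rewrite -leNgt; lra.
  by near=> s; rewrite (near fl s) // ltxx.
Unshelve. all: by end_near. Qed.

(** Moving down and right along the same line, the curves newly above the moving
    point are those through [(t, h)] that rise; the others run along the line. *)
Lemma above_right t h : 0 < h -> \forall s \near 0^'+,
  nat_of_bool (h - s < f (t + s))%R = ((h < f t)%R + `[< rises_right f t h >])%N.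
Proof.
move=> h0; have [hf|fh|fth] := ltgtP h (f t).
- rewrite (_ : `[< _ >] = false); last by apply/asboolP => -[]; lra.
  near=> s; rewrite (_ : h - s < _) //; apply: (@lt_trans _ _ h).
    by rewrite gtrBl.
  by near: s; exact: near_gt_right.
- rewrite (_ : `[< _ >] = false); last by apply/asboolP => -[]; lra.
  have mf : f t < (h + f t) / 2 by lra.
  near=> s; rewrite (_ : h - s < _ = false) //.
  apply/negbTE; rewrite -leNgt; apply: ltW; apply: (@lt_trans _ _ ((h + f t) / 2)).
    by near: s; exact: near_lt_right.
  have : s < (h - f t) / 2 by near: s; apply: nbhs_right_lt; lra.
  lra.
- have [rf|ff] := right_slope (esym fth) h0.
    rewrite (asboolT rf); case: rf => _ rf.
    near=> s; rewrite (near rf s) //; have s0 : 0 < s by [].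
    by rewrite (_ : h - s < _) //; lra.
  rewrite (_ : `[< _ >] = false); last first.
    by apply/asboolP => rf; exact: rises_falls_right rf ff.
  case: ff => _ ff.
  by near=> s; rewrite (near ff s) // ltxx.
Unshelve. all: by end_near. Qed.

(** Along a line of slope 1 a rising branch carries its right germ with it, so
    the germs seen just after [(t, h)] are its right germs and those seen just
    before are its left germs. *)
Lemma rises_right_up t h : 0 < h -> \forall s \near 0^'+,
  `[< rises_right f (t + s) (h + s) >] = `[< rises_right f t h >].
Proof.
move=> h0; have [fth|fth] := eqVneq (f t) h; last first.
  have gth : f t - t != h - t by apply: contra_neq fth; lra.
  have := near_right_of (@gcont t _ (near_neq gth)); apply: filterS => s /= fs.
  rewrite [RHS]asboolF; last by case=> fth'; move: fth; rewrite fth' eqxx.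
  apply/asboolF; case=> fts _; move: fs; rewrite fts; move/eqP; apply; ring.
have [rf|ff] := right_slope fth h0.
  rewrite (asboolT rf); case: rf => _ /near_right0P[e e0 fe].
  apply/near_right0P; exists e => // s s0 se; apply/asboolT; split; first exact: fe.
  apply/near_right0P; exists (e - s) => [|u u0 ue]; first by lra.
  by rewrite -addrA fe ?addrA//; lra.
have -> : `[< rises_right f t h >] = false.
  by apply/asboolF => rf; exact: rises_falls_right rf ff.
case: ff => _ ff; near=> s; apply/asboolF => -[+ _]; rewrite (near ff s) //.
have s0 : 0 < s by [].
lra.
Unshelve. all: by end_near. Qed.

Lemma rises_right_down t h : 0 < h -> \forall s \near 0^'+,
  `[< rises_right f (t - s) (h - s) >] = `[< rises_left f t h >].
Proof.
move=> h0; have [fth|fth] := eqVneq (f t) h; last first.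
  have gth : f t - t != h - t by apply: contra_neq fth; lra.
  have := near_left_of (@gcont t _ (near_neq gth)); apply: filterS => s /= fs.
  rewrite [RHS]asboolF; last by case=> fth'; move: fth; rewrite fth' eqxx.
  apply/asboolF; case=> fts _; move: fs; rewrite fts; move/eqP; apply; ring.
have [rf|ff] := left_slope fth h0.
  rewrite (asboolT rf); case: rf => _ /near_right0P[e e0 fe].
  apply/near_right0P; exists e => // s s0 se; apply/asboolT; split; first exact: fe.
  apply/near_right0P; exists s => // u u0 us.
  by rewrite (_ : t - s + u = t - (s - u)) ?fe; [ring|lra|lra|ring].
have -> : `[< rises_left f t h >] = false.
  by apply/asboolF => rf; exact: rises_falls_left rf ff.
case: ff => _ ff; near=> s; apply/asboolF => -[+ _]; rewrite (near ff s) //.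
have s0 : 0 < s by [].
lra.
Unshelve. all: by end_near. Qed.

(** Among the four combinations of slopes, a maximum is rise-then-fall, a minimum
    is fall-then-rise, and equal slopes make the curve derivable. Hence max
    minus min equals left rise minus right rise, written without subtraction. *)
Lemma local_extrema_rises t h : 0 < h ->
  (`[< is_local_max f t h >] + `[< rises_right f t h >] =
   `[< is_local_min f t h >] + `[< rises_left f t h >])%N.
Proof.
move=> h0; have [fth|fth] := eqVneq (f t) h; last first.
  rewrite !asboolF //.
  by case=> fth'; move: fth; rewrite fth' eqxx.
  by case=> fth'; move: fth; rewrite fth' eqxx.
  by case=> fth'; move: fth; rewrite fth' eqxx.
  by case=> fth'; move: fth; rewrite fth' eqxx.
have noncrit m : (\forall s \near 0^'+, f (t + s) = h + m * s) ->
    (\forall s \near 0^'+, f (t - s) = h - m * s) -> ~ critical f t.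
  move=> fr fl; apply; apply: (@derivable_near_affine _ _ _ m (h - m * t)).
  apply: near_two_sided; first by rewrite fth; ring.
    by apply: filterS fr => s ->; ring.
  by apply: filterS fl => s ->; ring.
have crit m n : m != n -> (\forall s \near 0^'+, f (t + s) = h + m * s) ->
    (\forall s \near 0^'+, f (t - s) = h - n * s) -> critical f t.
  rewrite -fth => mn fr fl df; move/eqP: mn; apply.
  by rewrite -(derive_right df fr) -(derive_left df fl).
have pos : \forall s \near (0:R)^'+, 0 < s by near=> s.
have [rr|fr] := right_slope fth h0; have [rl|fl] := left_slope fth h0.
- rewrite (asboolT rr) (asboolT rl) !asboolF// => -[_ + _];
  apply: (noncrit 1); case: rr rl => _ rr [_ rl];
    by [apply: filterS rr => s ->; ring|apply: filterS rl => s ->; ring].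
- rewrite (asboolT rr) [in RHS](asboolF (P := rises_left _ _ _)); last first.
    by move=> /rises_falls_left; apply.
  rewrite asboolF ?asboolT //.
    split=> //.
      apply: (crit 1 (-1)); first by apply/eqP; lra.
        by case: rr => _; apply: filterS => s ->; ring.
      by case: fl => _; apply: filterS => s ->; ring.
    apply: near_two_sided => //; rewrite fth.
      by case: rr => _; apply: filterS2 pos => s s0 ->; lra.
    by case: fl => _; apply: filterS2 pos => s s0 ->; lra.
  move=> [_ _ /near_right_of mx]; case: rr => _ rr; near (0:R)^'+ => s.
  have : f (t + s) <= f t by near: s.
  rewrite fth (near rr s) //; have : 0 < s by [].
  lra.
- rewrite (asboolT rl) [in LHS](asboolF (P := rises_right _ _ _)); last first.
    by move=> /rises_falls_right; apply.
  rewrite asboolT ?asboolF //.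
    move=> [_ _ /near_right_of mx]; case: fr => _ fr; near (0:R)^'+ => s.
    have : f t <= f (t + s) by near: s.
    rewrite fth (near fr s) //; have : 0 < s by [].
    lra.
  split=> //.
    apply: (crit (-1) 1); first by apply/eqP; lra.
      by case: fr => _; apply: filterS => s ->; ring.
    by case: rl => _; apply: filterS => s ->; ring.
  apply: near_two_sided => //; rewrite fth.
    by case: fr => _; apply: filterS2 pos => s s0 ->; lra.
  by case: rl => _; apply: filterS2 pos => s s0 ->; lra.
- rewrite [in LHS](asboolF (P := rises_right _ _ _)); last first.
    by move=> /rises_falls_right; apply.
  rewrite [in RHS](asboolF (P := rises_left _ _ _)); last first.
    by move=> /rises_falls_left; apply.
  rewrite !asboolF// => -[_ + _];
  apply: (noncrit (-1)); case: fr fl => _ fr [_ fl];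
    by [apply: filterS fr => s ->; ring|apply: filterS fl => s ->; ring].
Unshelve. all: by end_near. Qed.
End CurveGerms.

(** * The degree function determines the sequence *)

Section Counting.
Variable R : realType.
Implicit Types (l : nat -> R -> R) (t h : R).

Lemma near_sum (F : set_system R) {FF : Filter F} K (a : 'I_K -> R -> nat)
    (b : 'I_K -> nat) :
  (forall k, \forall s \near F, a k s = b k) ->
  \forall s \near F, (\sum_(k < K) a k s = \sum_(k < K) b k)%N.
Proof.
by move=> /filter_forall; apply: filterS => s ab; apply: eq_bigr.
Qed.

Lemma card_fset_set_bounded K (A : set nat) : (forall k, A k -> (k < K)%N) ->
  #|` fset_set A| = (\sum_(k < K) `[< A k >])%N.
Proof.
move=> AK.
have -> : fset_set A = [fset k in [seq k <- iota 0 K | `[< A k >]]]%fset.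
  have fA : finite_set A by apply: (sub_finite_set _ (finite_II K)) => k /AK.
  apply/fsetP => k; rewrite in_fset_set // !inE mem_filter mem_iota add0n /=.
  by apply/idP/andP => [Ak|[]//]; split => //; apply: AK; apply/asboolP.
rewrite card_fseq undup_id; last by rewrite filter_uniq // iota_uniq.
rewrite size_filter -sum1_count big_mkcond -{1}[K]subn0 -/(index_iota 0 K).
rewrite big_mkord.
by apply: eq_bigr => k _; case: ifP.
Qed.

Definition above_count l K t h := (\sum_(k < K) (h < l k t)%R)%N.
Definition right_count l K t h := (\sum_(k < K) `[< rises_right (l k) t h >])%N.
Definition left_count l K t h := (\sum_(k < K) `[< rises_left (l k) t h >])%N.

Section OneSequence.
Variables (l : nat -> R -> R) (K : nat).
Hypotheses (curve_l : forall k, landscape_curve (l k))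
  (zero_l : forall k, (K <= k)%N -> forall t, l k t = 0).

(** The degree is the loss of rising branches across the point [(t, h)]. *)
Lemma deg_count t h : 0 < h ->
  deg l t h = (left_count l K t h)%:Z - (right_count l K t h)%:Z.
Proof.
move=> h0.
have bnd k : l k t = h -> (k < K)%N.
  by move=> lk; rewrite ltnNge; apply/negP => /zero_l/(_ t) lk0; lra.
rewrite /deg (@card_fset_set_bounded K); last by move=> k [/bnd].
rewrite (@card_fset_set_bounded K); last by move=> k [/bnd].
have arith (a b c d : nat) : (a + b = c + d)%N -> a%:Z - c%:Z = d%:Z - b%:Z by lia.
apply: arith; rewrite -!big_split /=; apply: eq_bigr => k _.
exact: local_extrema_rises (curve_l k) _ _ h0.
Qed.

Lemma above_count_left t h : 0 < h ->
  \forall s \near 0^'+, above_count l K (t - s) (h + s) = above_count l K t h.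
Proof.
move=> h0; apply: near_sum => k.
by apply: filterS (above_left (curve_l k) t h0) => s ->.
Qed.

Lemma above_count_right t h : 0 < h -> \forall s \near 0^'+,
  above_count l K (t + s) (h - s) = (above_count l K t h + right_count l K t h)%N.
Proof.
move=> h0; rewrite /above_count /right_count -big_split /=.
by apply: near_sum => k; exact: above_right.
Qed.

Lemma right_count_up t h : 0 < h ->
  \forall s \near 0^'+, right_count l K (t + s) (h + s) = right_count l K t h.
Proof.
move=> h0; apply: near_sum => k.
by apply: filterS (rises_right_up (curve_l k) t h0) => s ->.
Qed.

Lemma right_count_down t h : 0 < h ->
  \forall s \near 0^'+, right_count l K (t - s) (h - s) = left_count l K t h.
Proof.
move=> h0; apply: near_sum => k.
by apply: filterS (rises_right_down (curve_l k) t h0) => s ->.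
Qed.
End OneSequence.

Lemma decreasing_le l : (forall k t, l k.+1 t <= l k t) ->
  forall i j t, (i <= j)%N -> l j t <= l i t.
Proof.
move=> dec i j t /subnKC <-; elim: (j - i)%N => [|n ih]; first by rewrite addn0.
by rewrite addnS; apply: le_trans ih.
Qed.

(** Equality of the counts on a vertical line orders the two sequences there:
    a height between [l1 k t] and a larger [l2 k t] would be exceeded by at
    least one more function of the second sequence. *)
Lemma le_of_above_count_eq l1 l2 K t :
  (forall k t, l1 k.+1 t <= l1 k t) -> (forall k t, l2 k.+1 t <= l2 k t) ->
  (forall k t, 0 <= l1 k t) ->
  (forall h, 0 < h -> above_count l1 K t h = above_count l2 K t h) ->
  forall k, (k < K)%N -> l2 k t <= l1 k t.
Proof.
move=> /decreasing_le dec1 /decreasing_le dec2 ge0 N12 k kK.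
rewrite leNgt; apply/negP => lt12.
have l1k := ge0 k t.
have h0 : 0 < (l1 k t + l2 k t) / 2 by lra.
suff : (above_count l1 K t ((l1 k t + l2 k t) / 2) <
        above_count l2 K t ((l1 k t + l2 k t) / 2))%N.
  by rewrite N12 // ltnn.
rewrite /above_count (bigD1 (Ordinal kK)) //=.
rewrite [X in (_ < X)%N](bigD1 (Ordinal kK)) //=.
have -> : (l1 k t + l2 k t) / 2 < l1 k t = false.
  by apply/negbTE; rewrite -leNgt; lra.
have -> : (l1 k t + l2 k t) / 2 < l2 k t by lra.
rewrite add0n add1n ltnS; apply: leq_sum => j _.
have [jk|kj] := leqP j k.
  rewrite [X in (_ <= nat_of_bool X)%N](_ : _ = true) ?leq_b1 //.
  by have := dec2 _ _ t jk; lra.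
rewrite (_ : (_ < l1 j t) = false) //; apply/negbTE; rewrite -leNgt.
by have := dec1 _ _ t (ltnW kj); lra.
Qed.

(** Two sweeps recover a sequence from its degree function. Going up a line of
    slope 1, the number of rising branches changes by the degrees met, and it
    vanishes far away; going up a line of slope -1, the number of functions
    above the moving point changes by the numbers of rising branches met, and it
    too vanishes far away. For two sequences the differences are thus constant,
    equal to 0. *)
Lemma deg_determines l1 l2 K M :
  (forall k, landscape_curve (l1 k)) -> (forall k, landscape_curve (l2 k)) ->
  (forall k t, l1 k.+1 t <= l1 k t) -> (forall k t, l2 k.+1 t <= l2 k t) ->
  (forall k, (K <= k)%N -> forall t, l1 k t = 0) ->
  (forall k, (K <= k)%N -> forall t, l2 k t = 0) ->
  (forall k t, M < `|t| -> l1 k t = 0) -> (forall k t, M < `|t| -> l2 k t = 0) ->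
  (forall t h, 0 < h -> deg l1 t h = deg l2 t h) ->
  l1 = l2.
Proof.
move=> c1 c2 dec1 dec2 z1 z2 s1 s2 deg12.
have M0 : forall t, exists2 s, 0 <= s & M < `|t - s| /\ M < `|t + s|.
  move=> t; exists (`|t| + `|M| + 1).
    by rewrite !addr_ge0.
  have := ler_norm M; have := ler_norm t; have := ler_norm (- t); rewrite normrN.
  move=> t1 t2 M1; split.
    rewrite distrC; apply: lt_le_trans (ler_norm _); lra.
  apply: lt_le_trans (ler_norm _); lra.
have right12 t h : 0 < h -> right_count l1 K t h = right_count l2 K t h.
  move=> h0; pose F s := (right_count l1 K (t + s) (h + s))%:Z
                       - (right_count l2 K (t + s) (h + s))%:Z.
  have [s s0 [_ tsM]] := M0 t.
  have : F 0 = F s.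
    apply: locally_constant_segment => // x /andP[x0 _].
    have hx : 0 < h + x by lra.
    apply: near_two_sided => //.
      apply: filterS2 (right_count_up K c1 (t + x) hx)
                      (right_count_up K c2 (t + x) hx).
      by move=> u; rewrite /F !addrA => -> ->.
    apply: filterS2 (right_count_down K c1 (t + x) hx)
                    (right_count_down K c2 (t + x) hx).
    have := deg12 (t + x) _ hx; rewrite (deg_count c1 z1) // (deg_count c2 z2) // => e u.
    rewrite /F !addrA => -> ->; lia.
  have -> : F s = 0.
    rewrite /F /right_count !big1 ?subrr // => k _; rewrite asboolF // => -[].
      by rewrite s2 //; lra.
    by rewrite s1 //; lra.
  by rewrite /F !addr0; lia.
have above12 t h : 0 < h -> above_count l1 K t h = above_count l2 K t h.
  move=> h0; pose F s := (above_count l1 K (t - s) (h + s))%:Z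
                       - (above_count l2 K (t - s) (h + s))%:Z.
  have [s s0 [tsM _]] := M0 t.
  have : F 0 = F s.
    apply: locally_constant_segment => // x /andP[x0 _].
    have hx : 0 < h + x by lra.
    apply: near_two_sided => //.
      apply: filterS2 (above_count_left K c1 (t - x) hx)
                      (above_count_left K c2 (t - x) hx).
      by move=> u; rewrite /F opprD !addrA => -> ->.
    apply: filterS2 (above_count_right K c1 (t - x) hx)
                    (above_count_right K c2 (t - x) hx).
    move=> u e1 e2; rewrite /F (_ : t - (x - u) = t - x + u); last by ring.
    by rewrite addrA e1 e2 right12//; lia.
  have -> : F s = 0.
    rewrite /F /above_count !big1 ?subrr // => k _.
      by rewrite s2 // ltNge (_ : 0 <= h + s) //; lra.
    by rewrite s1 // ltNge (_ : 0 <= h + s) //; lra.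
  by rewrite /F subr0 addr0; lia.
apply/funext => k; apply/funext => t.
have [kK|Kk] := ltnP k K; last by rewrite z1 // z2.
apply/eqP; rewrite eq_le; apply/andP; split.
  apply: (le_of_above_count_eq (K := K)) => // [j u|h h0].
    exact: curve_ge0.
  by rewrite above12.
apply: (le_of_above_count_eq (K := K)) => // [j u|h h0]; last exact: above12.
exact: curve_ge0.
Qed.
End Counting.

(** * The landscape of a persistence diagram *)

Section Landscape.
Variable R : realType.
Variable Y : PDgm R.
Implicit Types (t h : R) (k : nat).

(** The rank function with both inequalities strict. A landscape is a supremum,
    so its strict superlevel sets see the rank only up to the boundary of the
    quadrants, and this version is the one that describes them exactly. *)
Definition strict_rank t h :=
  (\sum_(p <- finsupp Y | (((val p).1 < t - h) && (t + h < (val p).2))%R)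
      Y p)%N.

Definition total_mult := (\sum_(p <- finsupp Y) Y p)%N.

Lemma leq_sum_pred (P Q : pred (R2lt R)) :
  (forall p, p \in finsupp Y -> P p -> Q p) ->
  (\sum_(p <- finsupp Y | P p) Y p <= \sum_(p <- finsupp Y | Q p) Y p)%N.
Proof.
move=> PQ; rewrite big_mkcond [leqRHS]big_mkcond /= big_seq [leqRHS]big_seq.
by apply: leq_sum => p pY; case: ifP => // /(PQ p pY) ->.
Qed.

Lemma eq_sum_pred (P Q : pred (R2lt R)) :
  (forall p, p \in finsupp Y -> P p = Q p) ->
  (\sum_(p <- finsupp Y | P p) Y p = \sum_(p <- finsupp Y | Q p) Y p)%N.
Proof.
by move=> PQ; apply/eqP; rewrite eqn_leq !leq_sum_pred // => p /PQ ->.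
Qed.

Lemma strict_rank_le t h t' h' : t' - h' <= t - h -> t + h <= t' + h' ->
  (strict_rank t' h' <= strict_rank t h)%N.
Proof. by move=> b d; apply: leq_sum_pred => p _; lra. Qed.

Lemma strict_rank_total t h : (strict_rank t h <= total_mult)%N.
Proof. exact: leq_sum_pred. Qed.

Lemma diagram_bound : exists M : R,
  forall p, p \in finsupp Y -> - M < (val p).1 /\ (val p).2 < M.
Proof.
have : \forall M \near +oo%R, forall p, p \in finsupp Y ->
    - M < (val p).1 /\ (val p).2 < M.
  apply: (@near_all_seq _ _ (+oo%R)) => p _; near=> M; split.
    rewrite ltrNl; near: M; by apply: nbhs_pinfty_gt; rewrite num_real.
  near: M; by apply: nbhs_pinfty_gt; rewrite num_real.
by move=> MY; near (+oo%R : set_system R) => M; exists M; near: M.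
Unshelve. all: by end_near. Qed.

Lemma landscape_ge0 k t : 0 <= landscape Y k t.
Proof.
rewrite /landscape; set S := [set h | _].
have [hS|/sup_out ->//] := pselect (has_sup S).
have [x Sx] := hS.1; apply: (@le_trans _ _ x); first by case: Sx.
by apply: ub_le_sup => //; exact: hS.2.
Qed.

(** Everything about landscapes is read off from this description of their
    superlevel sets. The direction from right to left holds because the strict
    inequalities defining [strict_rank] survive a small increase of [h]. *)
Lemma landscape_gt k t h : 0 <= h ->
  (h < landscape Y k t) = (k < strict_rank t h)%N.
Proof.
move=> h0; rewrite /landscape; set S := [set h | _].
have Sub : has_ubound S.
  have [M MY] := diagram_bound.
  exists M => u /= [u0 ku].
  have [|nY] := pselect (exists2 p, p \in finsupp Y &
    [&& (val p).1 <= t - u, t - u <= t + u & t + u < (val p).2]).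
    move=> [p /MY[M1 M2] /and3P[pu _ up]]; lra.
  move: ku; rewrite /rank big_seq_cond big_pred0 // => p.
  by apply/negP => /andP[pY pu]; apply: nY; exists p.
apply/idP/idP => [hS|kh].
  have S0 : S !=set0.
    apply/set0P; apply: contraTneq hS => ->.
    by rewrite sup0 -leNgt.
  have [u [u0 ku] hu] := sup_gt S0 hS.
  apply: leq_trans ku _; apply: leq_sum_pred => p _ /and3P[]; lra.
have : \forall s \near (0:R)^'+, forall p, p \in finsupp Y ->
    ((val p).1 < t - h) && (t + h < (val p).2) ->
    [&& (val p).1 <= t - (h + s), t - (h + s) <= t + (h + s)
      & t + (h + s) < (val p).2].
  apply: (@near_all_seq _ _ (0:R)^'+) => p _; apply/near_right0P.
  case: (ltP (val p).1 (t - h)) => [pt|]; last by exists 1.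
  case: (ltP (t + h) (val p).2) => [tp|]; last by exists 1.
  exists (Num.min (t - h - (val p).1) ((val p).2 - (t + h))).
    by rewrite lt_min; lra.
  by move=> s s0; rewrite lt_min => /andP[s1 s2] _; lra.
move=> /near_right0P[e e0 /(_ (e / 2))] H.
have {}H := H ltac:(lra) ltac:(lra).
apply: (@lt_le_trans _ _ (h + e / 2)); first by lra.
apply: ub_le_sup => //=; split; first by lra.
by apply: leq_trans kh _; apply: leq_sum_pred.
Qed.

Lemma landscape_decreasing k t : landscape Y k.+1 t <= landscape Y k t.
Proof.
rewrite leNgt; apply/negP; rewrite landscape_gt ?landscape_ge0 // => /ltnW.
by rewrite -landscape_gt ?landscape_ge0 // ltxx.
Qed.

Lemma landscape_eq0 k t : (total_mult <= k)%N -> landscape Y k t = 0.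
Proof.
move=> Yk; apply/eqP; rewrite eq_le landscape_ge0 andbT leNgt landscape_gt //.
by rewrite -leqNgt; apply: leq_trans Yk; exact: strict_rank_total.
Qed.

(** The strict rank is monotone along both diagonals. *)
Lemma landscape_lipschitz k t t' :
  landscape Y k t' <= landscape Y k t + `|t' - t|.
Proof.
have l0 := landscape_ge0 k t.
have n1 := ler_norm (t' - t); have n2 := ler_norm (- (t' - t)); rewrite normrN in n2.
rewrite leNgt landscape_gt; last by rewrite addr_ge0.
apply/negP => H; suff : landscape Y k t < landscape Y k t by rewrite ltxx.
rewrite landscape_gt //; apply: leq_trans H _; apply: strict_rank_le; lra.
Qed.

Lemma landscape_continuous k : continuous (landscape Y k).
Proof.
move=> t; apply/cvgrPdist_le => e e0; apply/near_ballP; exists e => // x xt.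
have := landscape_lipschitz k t x; have := landscape_lipschitz k x t.
rewrite (distrC t x) ler_norml; lra.
Qed.

Lemma landscape_bounded_support : exists M : R,
  forall k t, M < `|t| -> landscape Y k t = 0.
Proof.
have [M MY] := diagram_bound; exists M => k t Mt.
apply/eqP; rewrite eq_le landscape_ge0 andbT leNgt landscape_gt //.
rewrite /strict_rank big_seq_cond big_pred0 // => p.
apply/negP => /andP[/MY[M1 M2] p12].
by move: Mt; have [t0|t0] := leP 0 t; [rewrite ger0_norm|rewrite ltr0_norm]; lra.
Qed.

(** The lines carrying the sides of the tents over the points of [Y], together
    with the axis. *)
Definition tent_lines : seq (R * R) :=
  (0, 0) :: [seq (1, - (val p).1) | p <- finsupp Y] ++
            [seq (-1, (val p).2) | p <- finsupp Y].

(** If a positive value [v] of a landscape lies on none of these lines, then the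
    strict rank does not change when the height goes slightly below [v],
    although [v] is the threshold at which it drops to [k] or less. *)
Lemma landscape_selection k t :
  exists2 l, l \in tent_lines & landscape Y k t = l.1 * t + l.2.
Proof.
have [l0|l0] := eqVneq (landscape Y k t) 0.
  by exists (0, 0); rewrite ?mem_head //= l0; ring.
have {l0}lpos : 0 < landscape Y k t by rewrite lt_neqAle eq_sym l0 landscape_ge0.
set v := landscape Y k t in lpos *.
apply: contrapT => nex.
have nb p : p \in finsupp Y -> v != t - (val p).1.
  move=> pY; apply/eqP => vp; apply: nex; exists (1, - (val p).1).
    by rewrite inE mem_cat map_f ?orbT.
  by rewrite vp /=; ring.
have nd p : p \in finsupp Y -> v != (val p).2 - t.
  move=> pY; apply/eqP => vp; apply: nex; exists (-1, (val p).2).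
    by rewrite inE mem_cat [X in _ || (_ || X)]map_f ?orbT.
  by rewrite vp /=; ring.
have : \forall h \near v, forall p, p \in finsupp Y ->
    ((val p).1 < t - h) && (t + h < (val p).2) =
    ((val p).1 < t - v) && (t + v < (val p).2).
  apply: (@near_all_seq _ _ (nbhs v)) => p pY; apply/near_ballP.
  exists (Num.min `|v - (t - (val p).1)| `|v - ((val p).2 - t)|).
    by rewrite lt_min !normr_gt0 !subr_eq0 nb // nd.
  move=> h; rewrite lt_min => /andP[hb hd].
  congr andb.
    case: (ltP (val p).1 (t - v)) => pt; apply/idP => //.
      by move: hb; rewrite [ltRHS]ltr0_norm ?ltr_norml; lra.
    by apply/negP; rewrite -leNgt; move: hb; rewrite [ltRHS]ger0_norm ?ltr_norml; lra.
  case: (ltP (t + v) (val p).2) => pt; apply/idP => //.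
    by move: hd; rewrite [ltRHS]ltr0_norm ?ltr_norml; lra.
  by apply/negP; rewrite -leNgt; move: hd; rewrite [ltRHS]ger0_norm ?ltr_norml; lra.
move=> /near_left_of near_v; near (0:R)^'+ => s; have s0 : 0 < s by [].
have sv : s < v by near: s; exact: nbhs_right_lt.
have : v - s < v by lra.
have : v < v = false by rewrite ltxx.
rewrite /v !landscape_gt -/v; [|lra|lra].
rewrite {2}/strict_rank.
by rewrite (eq_sum_pred (near near_v s _)) // -/(strict_rank t v) => ->.
Unshelve. all: by end_near. Qed.

Lemma landscape_landscape_curve k : landscape_curve (landscape Y k).
Proof.
have pl := continuous_selection_piecewise (@landscape_continuous k)
             (landscape_selection k).
split.
- exact: landscape_ge0.
- exact: landscape_continuous.
- have [s fs] := pl; exists s => a b free; have [ab|ba|->] := ltgtP a b.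
  + by have [m [c [_ mc]]] := fs a b ab free; exists m, c.
  + by exists 0, 0 => x xab; lra.
  + by exists 0, (landscape Y k b) => x xb; rewrite (_ : x = b); [ring|lra].
- have [M MY] := landscape_bounded_support.
  apply: (@subclosed_compact _ _ `[- M, M]%classic).
  + exact: closed_closure.
  + exact: segment_compact.
  + rewrite /Defs.support closureE; apply: smallest_sub; first exact: itv_closed.
    move=> t /= /eqP lt; rewrite in_itv /= -ler_norml leNgt.
    by apply/negP => /(MY k).
- exact: piecewise_in_critical pl.
- move=> t supp /contrapT df.
  have [m [c [mcL ft fr]]] := piecewise_in_right t pl.
  have [m' [c' [mcL' ft' fl]]] := piecewise_in_left t pl.
  have fm : (landscape Y k)^`()%classic t = m.
    by apply: derive_right => //; apply: filterS fr => s ->; rewrite ft; ring.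
  have fm' : (landscape Y k)^`()%classic t = m'.
    by apply: derive_left => //; apply: filterS fl => s ->; rewrite ft'; ring.
  have mm : m' = m by rewrite -fm fm'.
  rewrite fm; move: mcL; rewrite inE mem_cat.
  move=> /orP[/eqP[m0 c0]|/orP[]]; last first.
  + by move=> /mapP[p _ [-> _]]; right.
  + by move=> /mapP[p _ [-> _]]; left.
  (* Both pieces at t are the axis, so t is not in the support. *)
  exfalso; case: (supp [set x | landscape Y k x = 0]); last by move=> x [/= /eqP].
  move: ft fr ft' fl; rewrite mm m0 c0 !mul0r !add0r => ft fr ft' fl.
  apply: near_two_sided => //.
    by apply: filterS fr => s /= ->; ring.
  by apply: filterS fl => s /= ->; lra.
Qed.

Lemma above_count_landscape t h : 0 <= h ->
  above_count (landscape Y) total_mult t h = strict_rank t h.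
Proof.
move=> h0; rewrite /above_count.
under eq_bigr do rewrite landscape_gt //.
have := strict_rank_total t h; set n := strict_rank t h => nT.
rewrite -(big_mkord xpredT (fun k => nat_of_bool (k < n)%N)).
rewrite (big_cat_nat (n := n)) //= big_nat.
rewrite (eq_bigr (fun=> 1%N)) => [|k /andP[_ ->]//].
rewrite [X in (_ + X)%N]big_nat [X in (_ + X)%N]big1 => [|k /andP[nk _]].
  2: by rewrite ltnNge nk.
by rewrite -big_nat sum_nat_const_nat muln1 subn0 addn0.
Qed.

(** What [right_count] is for a landscape: the points of [Y] whose tent has its
    rising side through [(t, h)], the summit excluded. *)
Definition birth_count t h :=
  (\sum_(p <- finsupp Y | (((val p).1 == t - h) && (t + h < (val p).2))%R)
      Y p)%N.

Lemma near_predU (F : set_system R) {FF : Filter F}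
    (P : R -> pred (R2lt R)) (Q Q' : pred (R2lt R)) :
  (forall p, \forall s \near F, P s p = Q p || Q' p) ->
  (forall p, ~~ (Q p && Q' p)) ->
  \forall s \near F, (\sum_(p <- finsupp Y | P s p) Y p =
   \sum_(p <- finsupp Y | Q p) Y p + \sum_(p <- finsupp Y | Q' p) Y p)%N.
Proof.
move=> PQ QQ.
have : \forall s \near F, forall p, p \in (finsupp Y : seq _) ->
    P s p = Q p || Q' p.
  exact: near_all_seq.
apply: filterS => s Ps; rewrite (eq_sum_pred Ps) big_mkcond [X in (X + _)%N]big_mkcond.
rewrite [X in (_ + X)%N]big_mkcond -big_split /=; apply: eq_bigr => p _.
by have := QQ p; case: (Q p) (Q' p) => -[]; rewrite ?addn0.
Qed.

Lemma strict_rank_right t h : \forall s \near 0^'+,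
  strict_rank (t + s) (h - s) = (strict_rank t h + birth_count t h)%N.
Proof.
apply: near_predU => p; last first.
  by apply/negP => /andP[/andP[p1 _] /andP[/eqP p2 _]]; lra.
apply/near_right0P.
exists (if t - h < (val p).1 then ((val p).1 - (t - h)) / 2 else 1).
  by case: ifP => //; lra.
move=> s s0 se; rewrite (_ : t + s + (h - s) = t + h); last by ring.
rewrite -andb_orl; congr andb; rewrite orbC -le_eqVlt.
move: se; case: (ltP (t - h) (val p).1) => pt se; apply/idP; lra.
Qed.

(** Both sides are the jump, from [(t, h)] to the lower right, of the number of
    landscape functions above a point. *)
Lemma right_count_landscape t h : 0 < h ->
  right_count (landscape Y) total_mult t h = birth_count t h.
Proof.
move=> h0; near (0:R)^'+ => s.
have sh : s < h by near: s; exact: nbhs_right_lt.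
have H : strict_rank (t + s) (h - s) = (strict_rank t h + birth_count t h)%N.
  by near: s; exact: strict_rank_right.
have : above_count (landscape Y) total_mult (t + s) (h - s) =
  (above_count (landscape Y) total_mult t h + right_count (landscape Y) total_mult t h)%N.
  by near: s; apply: above_count_right => // k; exact: landscape_landscape_curve.
rewrite !above_count_landscape ?H; [|lra|lra].
by move/addnI.
Unshelve. all: by end_near. Qed.

Lemma birth_count_down t h : \forall s \near 0^'+,
  birth_count (t - s) (h - s) =
  (birth_count t h +
   \sum_(p <- finsupp Y | (((val p).1 == t - h) && ((val p).2 == t + h))%R)
      Y p)%N.
Proof.
apply: near_predU => p; last first.
  by apply/negP => /andP[/andP[_ p1] /andP[_ /eqP p2]]; lra.
apply/near_right0P.
exists (if (val p).2 < t + h then ((t + h) - (val p).2) / 2 else 1).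
  by case: ifP => //; lra.
move=> s s0 se; rewrite (_ : t - s - (h - s) = t - h); last by ring.
rewrite -andb_orr; congr andb; rewrite orbC eq_sym -le_eqVlt.
move: se; case: (ltP (val p).2 (t + h)) => pt se; apply/idP; lra.
Qed.

(** The diagram is the degree function of its landscape: a rising side ends
    exactly at the summits of the tents, each with its multiplicity. *)
Lemma deg_landscape (p : R2lt R) :
  deg (landscape Y) (((val p).1 + (val p).2) / 2)
    (((val p).2 - (val p).1) / 2) = (Y p)%:Z.
Proof.
set t := _ / 2; set h := _ / 2.
have h0 : 0 < h by rewrite /h; have := valP p; rewrite /=; lra.
have cl := landscape_landscape_curve.
rewrite (deg_count cl (fun k Kk t => landscape_eq0 t Kk) t h0).
have -> : left_count (landscape Y) total_mult t h = (birth_count t h + Y p)%N.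
  near (0:R)^'+ => s.
  have sh : s < h by near: s; exact: nbhs_right_lt.
  rewrite -(near (right_count_down total_mult cl t h0) s) //.
  rewrite right_count_landscape; last by lra.
  rewrite (near (birth_count_down t h) s) //; congr addn.
  rewrite (eq_sum_pred (Q := pred1 p)) => [|q _]; last first.
    rewrite /= -val_eqE /= (_ : t - h = (val p).1); last by rewrite /t /h; field.
    by rewrite (_ : t + h = (val p).2) //; rewrite /t /h; field.
  have [pY|pY] := boolP (p \in finsupp Y).
    by rewrite -big_filter filter_pred1_uniq ?fset_uniq // big_seq1.
  rewrite big_seq_cond big_pred0; first by rewrite fsfun_dflt.
  by move=> q; apply/negP => /andP[qY /eqP qp]; rewrite -qp qY in pY.
rewrite right_count_landscape //; lia.
Unshelve. all: by end_near. Qed.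
End Landscape.

(** * The bijection *)

Section Realization.
Variable R : realType.

Lemma diagram_of_function (m : R2lt R -> nat) :
  finite_set [set p | m p != 0%N] -> exists Y : PDgm R, forall p, Y p = m p.
Proof.
move=> fm; exists [mset[tt] p in fset_set [set p | m p != 0%N] => m p]%mset => p.
rewrite fsfunE; have [mp|mp] := eqVneq (m p) 0%N; first by case: ifP.
by rewrite ifT // in_fset_set //; exact: mem_set.
Qed.

(** A point of nonzero degree is a critical point of one of the finitely many
    nonzero functions. *)
Lemma deg_finite_support (l : nat -> R -> R) : landscape_sequence l ->
  finite_set [set p : R2lt R |
    `|deg l (((val p).1 + (val p).2) / 2)
            (((val p).2 - (val p).1) / 2)|%N != 0%N].
Proof.
move=> [curve_l _ [K zero_l] _].
pose A := \bigcup_(k < K)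
  ((fun t => (t - l k t, t + l k t)) @` [set t | critical (l k) t]).
have fA : finite_set A.
  apply: bigcup_finite; first exact: finite_II.
  by move=> k _; apply: finite_image; exact: curve_finite_critical.
apply: (sub_finite_set (B := (val : R2lt R -> _) @^-1` A)); last first.
  by apply: finite_preimage fA => p q _ _; exact: val_inj.
move=> p /=; set t := _ / 2; set h := _ / 2 => degp.
have h0 : 0 < h by rewrite /h; have := valP p; rewrite /=; lra.
apply: contrapT => pA; move/negP: degp; apply; rewrite absz_eq0.
have ncrit k : l k t = h -> ~ critical (l k) t.
  move=> lk ck; apply: pA; exists k.
    rewrite /= ltnNge; apply/negP => /zero_l/(_ t) lk0; lra.
  exists t => //; rewrite lk /t /h [RHS]surjective_pairing.
  by congr pair; field.
rewrite /deg (_ : [set k | is_local_max (l k) t h] = set0); last first.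
  by apply/seteqP; split=> // k [/ncrit].
rewrite (_ : [set k | is_local_min (l k) t h] = set0) ?subrr //.
by apply/seteqP; split=> // k [/ncrit].
Qed.

Lemma landscape_sequence_bounded_support (l : nat -> R -> R) :
  landscape_sequence l ->
  exists M, forall k t, M < `|t| -> l k t = 0.
Proof.
move=> [curve_l dec _ _].
have /compact_bounded[M [_ /(_ (M + 1))]] := curve_compact_support (curve_l 0%N).
rewrite ltrDl => /(_ ltr01) /= bM; exists (M + 1) => k t Mt.
have l0 : l 0%N t = 0.
  apply: contraTeq Mt => l0; rewrite -leNgt; apply: bM.
  by apply: subset_closure => /=.
apply/eqP; rewrite eq_le (curve_ge0 (curve_l k)) andbT -l0.
exact: decreasing_le.
Qed.

Lemma exists_summit (t h : R) : 0 < h ->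
  exists p : R2lt R, val p = (t - h, t + h).
Proof.
move=> h0; have p0 : (t - h, t + h).1 < (t - h, t + h).2 by rewrite /=; lra.
by exists (exist (fun p : R * R => p.1 < p.2) _ p0).
Qed.

Lemma deg_landscape_at (Y : PDgm R) t h (p : R2lt R) :
  val p = (t - h, t + h) -> deg (landscape Y) t h = (Y p)%:Z.
Proof.
move=> pE; rewrite -deg_landscape pE /=.
rewrite (_ : (t - h + (t + h)) / 2 = t); last by field.
by rewrite (_ : (t + h - (t - h)) / 2 = h); last by field.
Qed.

Lemma landscape_landscape_sequence (Y : PDgm R) :
  landscape_sequence (landscape Y).
Proof.
split.
- exact: landscape_landscape_curve.
- exact: landscape_decreasing.
- by exists (total_mult Y) => k Yk t; exact: landscape_eq0.
- move=> t h h0; have [p pE] := exists_summit t h0.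
  by rewrite (deg_landscape_at Y pE).
Qed.

Lemma landscape_inj : injective (@landscape R).
Proof.
move=> Y Y' YY'; apply/msetP => p; apply/eqP; rewrite -eqz_nat; apply/eqP.
by rewrite -!deg_landscape YY'.
Qed.

(** The preimage is the degree function itself; it is a multiset because degrees
    are nonnegative, and its landscape has the same degrees as [l]. *)
Lemma landscape_surj (l : nat -> R -> R) : landscape_sequence l ->
  exists Y : PDgm R, l = landscape Y.
Proof.
move=> seq_l; have [Y YE] := diagram_of_function (deg_finite_support seq_l).
exists Y.
have [K zero_l] := seq_eventually_zero seq_l.
have [M bM] := landscape_sequence_bounded_support seq_l.
have [M' bM'] := landscape_bounded_support Y.
apply: (@deg_determines _ _ _ (maxn K (total_mult Y)) (Num.max M M')).
- exact: seq_curve.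
- exact: landscape_landscape_curve.
- exact: seq_decreasing.
- exact: landscape_decreasing.
- by move=> k; rewrite geq_max => /andP[/zero_l].
- by move=> k; rewrite geq_max => /andP[_ Yk] t; exact: landscape_eq0.
- by move=> k t; rewrite gt_max => /andP[/bM].
- by move=> k t; rewrite gt_max => /andP[_ /bM'].
move=> t h h0; have [p pE] := exists_summit t h0.
rewrite (deg_landscape_at Y pE) // YE pE /=.
rewrite (_ : (t - h + (t + h)) / 2 = t); last by field.
rewrite (_ : (t + h - (t - h)) / 2 = h); last by field.
by rewrite gez0_abs //; exact: seq_deg_ge0.
Qed.
End Realization.

Theorem theorem3p13 (R : realType) :
  set_bij [set: PDgm R] [set l : nat -> R -> R | landscape_sequence l]
    (@landscape R) /\
  (forall Y : PDgm R, landscape_sequence (landscape Y)) /\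
  (forall l : nat -> R -> R, landscape_sequence l ->
     exists! Y : PDgm R, l = landscape Y).
Proof.
split; last split.
- split.
  + by move=> Y _; exact: landscape_landscape_sequence.
  + by move=> Y Y' _ _; exact: landscape_inj.
  + by move=> l /landscape_surj[Y ->]; exists Y.
- exact: landscape_landscape_sequence.
- move=> l /landscape_surj[Y ->]; exists Y; split=> // Y'.
  exact: landscape_inj.
Qed.
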